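(* Let $X$ be a compact metric space, $c\in C(X\times X)$, $\mu,\nu,\lambda\in\mathcal{P}(X)$ and $n\in\mathbb{N}=\{1,2,\dots\}$. Then $$(c_\#)_n^\lambda(\mu,\nu)=\sup_{f\in C(X)}\Big[(c_{f,n})_\#(\mu,\nu)+n\int_X f\,d\lambda\Big].$$
   Context: $\mathcal{P}(X)$ is the set of Borel probability measures on $X$; $\Pi(\mu,\nu)$ is the set of Borel probability measures on $X\times X$ with first marginal $\mu$ and second marginal $\nu$. For a continuous $b:X\times X\to\mathbb{R}$, $b_\#(\mu,\nu):=\inf_{\pi\in\Pi(\mu,\nu)}\int_{X\times X}b\,d\pi$. For $f\in C(X)$ the weighted reduced cost function is $$c_{f,n}(x,y)=\min\Big\{\sum_{i=0}^n c(x_i,x_{i+1})-\sum_{i=1}^n f(x_i):\ x_1,\dots,x_n\in X,\ x_0=x,\ x_{n+1}=y\Big\}.$$ For $\lambda\in\mathcal{P}(X)$, $$(c_\#)_n^\lambda(\mu,\nu)=\min\Big\{\sum_{i=0}^n c_\#(\rho_i,\rho_{i+1}):\ \rho_1,\dots,\rho_n\in\mathcal{P}(X),\ \sum_{i=1}^n\rho_i=n\lambda,\ \rho_0=\mu,\ \rho_{n+1}=\nu\Big\}.$$ *)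

(* Defs.v *)
From HB Require Import structures.
From mathcomp Require Import all_boot all_order all_algebra.
From mathcomp Require Import all_classical all_reals all_analysis.

Set Implicit Arguments.
Unset Strict Implicit.
Unset Printing Implicit Defensive.

Import Order.TTheory GRing.Theory Num.Theory.
Import numFieldNormedType.Exports.
Local Open Scope classical_set_scope.
Local Open Scope ring_scope.

(* Metric spaces with a distinguished point: [measurableType] is only available
   on pointed types. The point is never used below, and a space that carries a
   probability measure is nonempty. *)
#[short(type="pMetricType")]
HB.structure Definition PointedMetric (R : numDomainType) :=
  {X of Pointed X & Metric R X}.

(* Makes products of pointed topological spaces pointed topological spaces. *)
HB.saturate prod.

Definition borel (T : ptopologicalType) := g_sigma_algebraType (@open T).

Definition is_min (R : realType) (A : set R) (m : R) := A m /\ lbound A m.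

Section costs.
Context {R : realType} {X : pMetricType R}.

(* The sigma-algebra on [X * X] is the Borel one of the product topology.
   Measures in the library are total on [set T] and unconstrained outside the
   measurable sets, so identities between them are stated on measurable sets. *)
Definition coupling (mu nu : probability (borel X) R) :
    set (probability (borel (X * X)%type) R) :=
  [set pi | forall A : set (borel X), measurable A ->
     pushforward pi (fst : borel (X * X)%type -> borel X) A = mu A /\
     pushforward pi (snd : borel (X * X)%type -> borel X) A = nu A].

Definition transport_cost (b : X * X -> R) (mu nu : probability (borel X) R) : R :=
  inf [set (\int[pi]_z b z)%R | pi in coupling mu nu].

(* Intermediate points are the values at [1, ..., n] of a sequence on [nat];
   its values beyond [n.+1] play no role. *)
Definition chain_cost_values (c : X * X -> R) (f : X -> R) (n : nat)
    (z : X * X) : set R :=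
  [set \sum_(0 <= i < n.+1) c (x i, x i.+1) - \sum_(1 <= i < n.+1) f (x i) |
     x in [set x : nat -> X | x 0%N = z.1 /\ x n.+1 = z.2]].

Definition reduced_cost (c : X * X -> R) (f : X -> R) (n : nat) (z : X * X) : R :=
  inf (chain_cost_values c f n z).

Lemma reduced_costP (c : X * X -> R) (f : X -> R) (n : nat) (z : X * X) :
  compact [set: X] -> continuous c -> continuous f ->
  is_min (chain_cost_values c f n z) (reduced_cost c f n z).
Proof.
move=> cX cc cf.
pose cost (x : {ptws nat -> X}) : R :=
  \sum_(0 <= i < n.+1) c (x i, x i.+1) - \sum_(1 <= i < n.+1) f (x i).
pose K i := if i == 0%N then [set z.1] else
            if i == n.+1 then [set z.2] else [set: X].
pose A : set {ptws nat -> X} := [set x | forall i, K i (x i)].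
have AE : A = [set x : nat -> X | x 0%N = z.1 /\ x n.+1 = z.2].
  apply/seteqP; split => [x Ax|x [x0 xn] i]; rewrite /K.
    by split; [exact: (Ax 0%N)|have := Ax n.+1; rewrite /K eqxx].
  by case: eqP => [->//|_]; case: eqP => [->//|_].
have A0 : A !=set0.
  by rewrite AE; exists (fun i => if i == 0%N then z.1 else z.2).
have cA : compact A.
  apply: (@tychonoff nat (fun=> X)) => i; rewrite /K.
  by do 2 (case: eqP => _; first exact: compact_set1).
have ev i : continuous (fun x : {ptws nat -> X} => x i).
  exact: (@proj_continuous nat (fun=> X) i).
have ccost : continuous cost.
  have csum m p (F : nat -> {ptws nat -> X} -> R) : (forall i, continuous (F i)) ->
      continuous (fun y => \sum_(m <= i < p) F i y).
    move=> cF; apply: (@continuous_big R nat +%R 0 xpredT) => // y.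
    by apply: (@cvgD R R (R*R)%type); [exact: cvg_fst|exact: cvg_snd].
  move=> y; apply: (@continuousB R R _
    (fun x : {ptws nat -> X} => \sum_(0 <= i < n.+1) c (x i, x i.+1))
    (fun x : {ptws nat -> X} => \sum_(1 <= i < n.+1) f (x i))).
    apply: (csum _ _ (fun i (x : {ptws nat -> X}) => c (x i, x i.+1))) => i {}y.
    apply: (@continuous_comp _ _ _
      (fun x : {ptws nat -> X} => (x i, x i.+1)) c); last exact: cc.
    exact: (@cvg_pair {ptws nat -> X} X X (nbhs y) (nbhs (y i)) (nbhs (y i.+1))
      _ _ _ (fun x => x i) (fun x => x i.+1) (ev i y) (ev i.+1 y)).
  apply: (csum _ _ (fun i (x : {ptws nat -> X}) => f (x i))) => i {}y.
  apply: (@continuous_comp _ _ _ (fun x : {ptws nat -> X} => x i) f).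
    exact: ev.
  exact: cf.
have [x /set_mem Ax xmin] := compact_EVT_min A0 cA (continuous_subspaceT ccost).
have mx : is_min (chain_cost_values c f n z) (cost x).
  split; first by exists x => //; rewrite AE in Ax.
  by move=> _ [y yP <-]; apply: xmin; rewrite inE AE.
suff -> : reduced_cost c f n z = cost x by [].
case: mx => xV xL; apply/eqP; rewrite eq_le; apply/andP; split.
  by apply: ge_inf => //; exists (cost x).
by apply: lb_le_inf => //; exists (cost x).
Qed.

Definition constrained_cost_values (c : X * X -> R) (n : nat)
    (lambda mu nu : probability (borel X) R) : set R :=
  [set \sum_(0 <= i < n.+1) transport_cost c (rho i) (rho i.+1) |
     rho in [set rho : nat -> probability (borel X) R |
       [/\ rho 0%N = mu, rho n.+1 = nu &
           forall A : set (borel X), measurable A ->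
             (\sum_(1 <= i < n.+1) rho i A = n%:R%:E * lambda A)%E]]].

Definition constrained_cost (c : X * X -> R) (n : nat)
    (lambda mu nu : probability (borel X) R) : R :=
  inf (constrained_cost_values c n lambda mu nu).

End costs.

(* Main.v *)
(* Call a triple of continuous functions (phi, psi, f) admissible if
     phi x_0 + psi x_(n+1) + sum_(1 <= i <= n) f x_i
       <= sum_(0 <= i <= n) c (x_i, x_(i+1))
   for all chains x, and let D be the supremum of
   int phi dmu + int psi dnu + n int f dlambda over the admissible triples.

   The Hahn-Banach theorem extends the functional that sends
   phi x_0 + psi x_(n+1) + sum f x_i to the integral above to a positive
   functional on bounded functions of chains whose value at the total cost is at
   most D.  To represent it by a measure, chains are parametrized by sequences of
   points of the Cantor space, which surjects onto X: there the functional
   restricts to a content on the clopen sets, which is sigma-additive by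
   compactness, and continuous functions are uniform limits of clopen step
   functions.  The marginals of this measure form a feasible (rho_i) of cost at
   most D, and D is at most the supremum of the theorem, because admissibility
   means phi x + psi y <= c_{f,n}(x, y).

   Conversely, for n = 0 the same argument is the Kantorovich duality.  Given f
   and almost optimal potentials phi, psi for the cost c_{f,n}, the iterated
   c-transforms u_0 = - phi, u_(i+1) y = min_x (u_i x + c (x, y)) - f y bound
   the cost of every step of a feasible (rho_i) from below, and these bounds
   telescope; so no gluing of couplings is needed. *)

Require Import Defs.
From HB Require Import structures.
From mathcomp Require Import all_boot all_order all_algebra.
From mathcomp Require Import all_classical all_reals all_analysis.
From mathcomp Require Import finmap measurable_realfun lra.

Set Implicit Arguments.
Unset Strict Implicit.
Unset Printing Implicit Defensive.

Import Order.TTheory GRing.Theory Num.Theory.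
Import numFieldNormedType.Exports.
Local Open Scope classical_set_scope.
Local Open Scope ring_scope.

(** * The Hahn-Banach theorem *)

Section hahn_banach.
Context {R : realType} {V : lmodType R}.
Implicit Types (p q : V -> R) (x y v : V).

Definition sublinear p :=
  (forall x y, p (x + y) <= p x + p y) /\
  (forall (a : R) x, 0 <= a -> p (a *: x) = a * p x).

Lemma sublinear0 p : sublinear p -> p 0 = 0.
Proof. by case=> _ pZ; rewrite -(scale0r (0 : V)) pZ // mul0r. Qed.

Lemma sublinearN p x : sublinear p -> - p (- x) <= p x.
Proof.
by move=> sp; have := sp.1 x (- x); rewrite subrr (sublinear0 sp); lra.
Qed.

(** The auxiliary functional of the Hahn-Banach proof: for a sublinear [q], [t = 0] shows that it
    lies below [q], and [t = 1] that its value at [- y] is at most [- q y]. It is therefore strictly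
    smaller than [q] somewhere unless [q (- y) = - q y]. *)
Definition sublinear_shift q y x :=
  inf [set q (x + t *: y) - t * q y | t in [set t : R | 0 <= t]].

(** Subadditivity on [t *: y = (x + t *: y) + (- x)]; the infimum is thus a genuine one. *)
Lemma sublinear_shift_lbound q y x : sublinear q ->
  lbound [set q (x + t *: y) - t * q y | t in [set t : R | 0 <= t]] (- q (- x)).
Proof.
move=> sq _ [t /= t0 <-].
by have := sq.1 (x + t *: y) (- x); rewrite addrAC subrr add0r sq.2 //; lra.
Qed.

Lemma sublinear_shift_le q y x (t : R) : sublinear q -> 0 <= t ->
  sublinear_shift q y x <= q (x + t *: y) - t * q y.
Proof.
move=> sq t0; apply: ge_inf; last by exists t.
by exists (- q (- x)); exact: sublinear_shift_lbound.
Qed.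

Lemma sublinear_shift_leP q y x (m : R) : sublinear q ->
  (forall t, 0 <= t -> m <= q (x + t *: y) - t * q y) ->
  m <= sublinear_shift q y x.
Proof.
move=> sq mq; apply: lb_le_inf => [|_ [t /= t0 <-]]; last exact: mq.
by exists (q (x + 0 *: y) - 0 * q y); exists 0 => /=.
Qed.

Lemma sublinear_shiftP q y : sublinear q -> sublinear (sublinear_shift q y).
Proof.
move=> sq; split => [x z|a x a0].
  rewrite -lerBlDr; apply: sublinear_shift_leP => // t t0.
  rewrite lerBlDr -lerBlDl; apply: sublinear_shift_leP => // s s0.
  rewrite lerBlDl.
  (* Parameters [t] for [x] and [s] for [z] combine to [t + s] for [x + z]. *)
  have := @sublinear_shift_le q y (x + z) (t + s) sq (addr_ge0 t0 s0).
  move/le_trans; apply.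
  have := sq.1 (x + t *: y) (z + s *: y).
  by rewrite addrACA -scalerDl mulrDl; lra.
have [->|an0] := eqVneq a 0.
  rewrite scale0r mul0r; apply/eqP; rewrite eq_le; apply/andP; split.
    apply: le_trans (@sublinear_shift_le q y 0 0 sq _) _ => //.
    by rewrite scale0r addr0 (sublinear0 sq) mul0r subrr.
  apply: sublinear_shift_leP => // t t0.
  by rewrite add0r sq.2 // subrr.
have {an0}a0 : 0 < a by rewrite lt_def an0.
apply/eqP; rewrite eq_le; apply/andP; split.
  rewrite mulrC -ler_pdivrMr //; apply: sublinear_shift_leP => // t t0.
  rewrite ler_pdivrMr //.
  have := @sublinear_shift_le q y (a *: x) (a * t) sq (mulr_ge0 (ltW a0) t0).
  by rewrite -scalerA -scalerDr sq.2 ?(ltW a0) //; lra.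
apply: sublinear_shift_leP => // t t0.
have ta0 : 0 <= t / a by rewrite divr_ge0 // ltW.
have := @sublinear_shift_le q y x (t / a) sq ta0.
rewrite -(ler_pM2l a0) => /le_trans; apply.
have ata : a * (t / a) = t by rewrite mulrC divfK // gt_eqF.
by rewrite mulrBr -(sq.2 a (x + _) (ltW a0)) scalerDr scalerA ata mulrA ata.
Qed.

(* Minimal sublinear functionals are linear: comparing a minimal [q] with
   [sublinear_shift q y] gives [q (- y) <= - q y]. *)
Lemma hahn_banach p v : sublinear p ->
  exists L : V -> R, [/\ forall x y, L (x + y) = L x + L y,
    forall (a : R) x, L (a *: x) = a * L x,
    forall x, L x <= p x & L v = p v].
Proof.
(* Working below [p'] instead of [p] forces the value at [v]: a functional below [p'] is at most
   [- p v] at [- v]. *)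
move=> sp; pose p' := sublinear_shift p v.
have sp' : sublinear p' by exact: sublinear_shiftP.
pose T := {q : V -> R | sublinear q /\ forall x, q x <= p' x}.
(* The order is reversed, so that a maximal element in Zorn's lemma is a minimal functional. *)
pose le_T (q r : T) := `[< forall x, sval r x <= sval q x >].
have [||||[q [sq qp]] qmin] := @Zorn T le_T.
- by move=> t; apply/asboolP.
- move=> r s t /asboolP rs /asboolP st; apply/asboolP => x.
  exact: le_trans (st x) (rs x).
- move=> [s sP] [t tP] /asboolP /= st /asboolP /= ts; apply: eq_exist.
  by apply/funext => x; apply/eqP; rewrite eq_le st ts.
- move=> A tA.
  have [[a0 Aa0]|A0] := pselect (A !=set0); last first.
    exists (exist (fun q => sublinear q /\ forall x, q x <= p' x) p'
      (conj sp' (fun=> lexx _))) => s As.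
    by exfalso; apply: A0; exists s.
  (* A nonempty chain is bounded by its pointwise infimum, which is finite because [- p' (- x)] lies
     below every member. *)
  pose E x := [set sval a x | a in A].
  have Elb x : lbound (E x) (- p' (- x)).
    move=> _ [[a [sa ap]] Aa <-] /=.
    by have := sublinearN x sa; have := ap (- x); lra.
  have Einf x a : A a -> inf (E x) <= sval a x.
    by move=> Aa; apply: ge_inf; [exists (- p' (- x)); exact: Elb|exists a].
  have Einf_ge x m : (forall a, A a -> m <= sval a x) -> m <= inf (E x).
    move=> mA; apply: lb_le_inf; first by exists (sval a0 x), a0.
    by move=> _ [a Aa <-]; exact: mA.
  have sE : sublinear (fun x => inf (E x)).
    split => [x y|a x age0].
      rewrite -lerBlDr; apply: (Einf_ge x) => a Aa.
      rewrite lerBlDr -lerBlDl; apply: (Einf_ge y) => b Ab; rewrite lerBlDl.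
      (* Since the chain is total, one of [a] and [b] is the smaller at every point, and its
         subadditivity suffices. *)
      have [/asboolP ab|/asboolP ba] := tA _ _ Aa Ab.
        apply: le_trans (Einf _ _ Ab) _; apply: le_trans ((svalP b).1.1 x y) _.
        by rewrite lerD2r.
      apply: le_trans (Einf _ _ Aa) _; apply: le_trans ((svalP a).1.1 x y) _.
      by rewrite lerD2l.
    have [->|an0] := eqVneq a 0.
      rewrite scale0r mul0r; apply/eqP; rewrite eq_le; apply/andP; split.
        by apply: le_trans (Einf _ _ Aa0) _; rewrite (sublinear0 (svalP a0).1).
      by apply: (Einf_ge 0) => b _; rewrite (sublinear0 (svalP b).1).
    have {an0}a_gt0 : 0 < a by rewrite lt_def an0.
    apply/eqP; rewrite eq_le; apply/andP; split.
      rewrite mulrC -ler_pdivrMr //; apply: (Einf_ge x) => b Ab.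
      rewrite ler_pdivrMr // mulrC -(svalP b).1.2 //; exact: Einf.
    apply: Einf_ge => b Ab; rewrite (svalP b).1.2 // ler_pM2l //; exact: Einf.
  have Ep x : inf (E x) <= p' x := le_trans (Einf x a0 Aa0) ((svalP a0).2 x).
  exists (exist (fun q => sublinear q /\ forall x, q x <= p' x) _ (conj sE Ep)).
  by move=> s As; apply/asboolP => x /=; exact: Einf.
have shift_le r y x : sublinear r -> sublinear_shift r y x <= r x.
  move=> sr; apply: le_trans (@sublinear_shift_le r y x 0 sr _) _ => //.
  by rewrite scale0r addr0 mul0r subr0.
have shiftN r y : sublinear r -> sublinear_shift r y (- y) <= - r y.
  move=> sr; apply: le_trans (@sublinear_shift_le r y (- y) 1 sr _) _ => //.
  by rewrite scale1r addNr (sublinear0 sr) mul1r sub0r.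
have qodd y : q (- y) = - q y.
  apply/eqP; rewrite eq_le; apply/andP; split; last first.
    by have := sublinearN (- y) sq; rewrite opprK.
  have sy : sublinear (sublinear_shift q y) /\
      forall x, sublinear_shift q y x <= p' x.
    split; first exact: sublinear_shiftP.
    by move=> x; apply: le_trans (qp x); exact: shift_le.
  have shiftE : sublinear_shift q y = q.
    have := qmin (exist (fun q => sublinear q /\ forall x, q x <= p' x) _ sy).
    move=> /(_ _)/(congr1 sval)/= -> //.
    by apply/asboolP => x /=; exact: shift_le.
  by rewrite -[in leLHS]shiftE; exact: shiftN.
exists q; split.
- move=> x y; apply/eqP; rewrite eq_le sq.1 /=.
  by have := sq.1 (- x) (- y); rewrite -opprD !qodd; lra.
- move=> a x; have [a0|a0] := leP 0 a; first exact: sq.2.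
  rewrite -[a]opprK scaleNr qodd sq.2 ?mulNr // oppr_ge0; exact: ltW.
- by move=> x; apply: le_trans (qp x) _; exact: shift_le.
- apply/eqP; rewrite eq_le; apply/andP; split.
    by apply: le_trans (qp v) _; exact: shift_le.
  by have := le_trans (qp (- v)) (shiftN p v sp); rewrite qodd; lra.
Qed.

End hahn_banach.

(** * Measures from functionals on a zero-dimensional compact space *)

Section bounded_functions.
Context {R : realType} {T : Type}.
Implicit Types f g : T -> R.

Definition bounded_real f := exists M, forall x, `|f x| <= M.

Lemma bounded_real_cst (a : R) : bounded_real (fun=> a).
Proof. by exists `|a|. Qed.

Lemma bounded_real_add f g : bounded_real f -> bounded_real g ->
  bounded_real (fun x => f x + g x).
Proof.
move=> [M fM] [N gN]; exists (M + N) => x.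
by rewrite (le_trans (ler_normD _ _)) // lerD.
Qed.

Lemma bounded_real_mul f g : bounded_real f -> bounded_real g ->
  bounded_real (fun x => f x * g x).
Proof. by move=> [M fM] [N gN]; exists (M * N) => x; rewrite normrM ler_pM. Qed.

Lemma bounded_real_indic (A : set T) : bounded_real \1_A.
Proof. by exists 1 => x; rewrite indicE; case: (x \in A); rewrite ?normr1 ?normr0. Qed.

Definition positive_functional (L : (T -> R) -> R) :=
  [/\ forall f g, bounded_real f -> bounded_real g ->
        L (fun x => f x + g x) = L f + L g,
      forall (a : R) f, bounded_real f -> L (fun x => a * f x) = a * L f,
      forall f, bounded_real f -> (forall x, 0 <= f x) -> 0 <= L f &
      L (fun=> 1) = 1].

Lemma positive_functional_le L f g : positive_functional L ->
  bounded_real f -> bounded_real g -> (forall x, f x <= g x) -> L f <= L g.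
Proof.
move=> [LD LZ Lge0 _] bf bg fg.
have bNf : bounded_real (fun x => -1 * f x).
  by apply: bounded_real_mul bf; exact: bounded_real_cst.
rewrite -subr_ge0 -mulN1r -LZ // -LD //; apply: Lge0; first exact: bounded_real_add.
by move=> x; rewrite mulN1r subr_ge0.
Qed.

End bounded_functions.

(** An alias of [K] that carries the algebra of clopen sets, on which contents can be defined and
    then extended to the generated sigma-algebra. *)
Definition clopen_type (K : ptopologicalType) : Type := K.
HB.instance Definition _ (K : ptopologicalType) := Pointed.on (clopen_type K).
HB.instance Definition _ (K : ptopologicalType) :=
  isAlgebraOfSets.Build default_measure_display (clopen_type K)
    (@clopen0 K) (@clopenU K) (fun A => @clopenC K A set0).

Definition clopen_sigma (K : ptopologicalType) :=
  g_sigma_algebraType (@measurable _ (clopen_type K)).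

Section clopen_content.
Context {R : realType} {K : ptopologicalType}.
Hypothesis cptK : compact [set: K].
Variable L : (K -> R) -> R.
Hypothesis Lpos : positive_functional L.

Definition clopen_content (A : set (clopen_type K)) : \bar R := (L (\1_A))%:E.

Let content0 : clopen_content set0 = 0%E.
Proof.
have [_ LZ _ _] := Lpos; rewrite /clopen_content indic0; congr _%:E.
transitivity (L (fun=> 0 * 1)); first by congr L; apply/funext => x; rewrite mul0r.
by rewrite LZ ?mul0r //; exact: bounded_real_cst.
Qed.

Let content_ge0 A : (0 <= clopen_content A)%E.
Proof.
have [_ _ Lge0 _] := Lpos; rewrite lee_fin; apply: Lge0 => //.
exact: bounded_real_indic.
Qed.

Let content_semi_additive : measure_function.semi_additive clopen_content.
Proof.
have [LD _ _ _] := Lpos.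
apply/(additive2P content0) => A B _ _ AB0.
rewrite /clopen_content -EFinD -LD; [|exact: bounded_real_indic..].
congr (L _)%:E; apply/funext => x; rewrite !indicE in_setU.
have [xA|xA] := boolP (x \in A); have [xB|xB] := boolP (x \in B);
  rewrite ?addr0 ?add0r //.
have : (A `&` B) x by split; apply: set_mem.
by rewrite AB0.
Qed.

HB.instance Definition _ := isContent.Build _ (clopen_type K) R
  clopen_content content_ge0 content_semi_additive.

(** A clopen set is compact and the members of the cover are open, so a countable cover reduces to a
    finite one, where additivity of the content is enough. *)
Let content_sigma_subadditive : measurable_subset_sigma_subadditive clopen_content.
Proof.
move=> A F mF mA AF.
have [D _ AD] : finite_subset_cover [set: nat] F (A : set K).
  have : cover_compact (A : set K).
    rewrite -compact_cover; apply: subclosed_compact cptK _ => //.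
    by case: mA.
  by apply => // i _; case: (mF i).
have : (clopen_content A <= \sum_(i \in [set` D]) clopen_content (F i))%E.
  exact: (@content_sub_fsum _ R (clopen_type K) clopen_content).
move=> /le_trans; apply; rewrite nneseries_esumT //; apply: esum_ge.
by exists [set` D].
Qed.

HB.instance Definition _ := Content_SigmaSubAdditive_isMeasure.Build
  _ R (clopen_type K) clopen_content content_sigma_subadditive.

Definition clopen_measure : set (clopen_sigma K) -> \bar R :=
  measure_extension clopen_content.

HB.instance Definition _ := Measure.on clopen_measure.

Lemma clopen_measureE (A : set K) : clopen A -> clopen_measure A = (L \1_A)%:E.
Proof. by move=> cA; rewrite /clopen_measure /measure_extension measurable_mu_extE. Qed.

Let clopen_measureT : clopen_measure setT = 1%E.
Proof.
have [_ _ _ L1] := Lpos.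
rewrite clopen_measureE; last exact: clopenT.
by rewrite indicT; congr _%:E.
Qed.

HB.instance Definition _ :=
  Measure_isProbability.Build _ _ _ clopen_measure clopen_measureT.

Lemma clopen_probability : exists s : probability (clopen_sigma K) R,
  forall A : set K, clopen A -> s A = (L \1_A)%:E.
Proof. by exists clopen_measure; exact: clopen_measureE. Qed.

End clopen_content.

Section bounded_integration.
Context {d} {T : measurableType d} {R : realType} (P : probability T R).
Implicit Types f g : T -> R.

Lemma bounded_integrable f : measurable_fun setT f -> bounded_real f ->
  P.-integrable setT (EFin \o f).
Proof.
move=> mf [M fM]; apply: measurable_bounded_integrable => //.
  by rewrite (le_lt_trans (probability_le1 P measurableT)) // ltry.
by exists M; split; [exact: num_real|move=> N MN x _; exact: le_trans (fM x) (ltW MN)].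
Qed.

Lemma Rintegral_indicT (A : set T) : measurable A ->
  (\int[P]_x \1_A x)%R = fine (P A).
Proof. by move=> mA; rewrite /Rintegral integral_indic // setIT. Qed.

Lemma Rintegral_le_add f g (e : R) :
  measurable_fun setT f -> bounded_real f ->
  measurable_fun setT g -> bounded_real g ->
  (forall x, f x <= g x + e) ->
  (\int[P]_x f x <= \int[P]_x g x + e)%R.
Proof.
move=> mf bf mg bg fg.
have ge_int : P.-integrable setT (EFin \o (fun x => g x + e)).
  apply: bounded_integrable; first by apply: measurable_funD => //; exact: measurable_cst.
  by apply: bounded_real_add bg _; exact: bounded_real_cst.
have -> : (\int[P]_x g x + e = \int[P]_x (g x + e))%R.
  rewrite RintegralD //; last 2 first.
  - exact: bounded_integrable.
  - by apply: bounded_integrable; [exact: measurable_cst|exact: bounded_real_cst].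
  rewrite [X in _ = _ + X]Rintegral_cst //. have PT : fine (P setT) = 1 by rewrite probability_setT.
  by rewrite PT mulr1.
by apply: le_Rintegral => //; exact: bounded_integrable.
Qed.

End bounded_integration.

(** * Riesz representation on a zero-dimensional compact Hausdorff space *)

Section riesz.
Context {R : realType} {K : ptopologicalType}.
Hypotheses (cptK : compact [set: K]) (hausK : hausdorff_space K)
  (zdK : zero_dimensional K).
Variable L : (K -> R) -> R.
Hypothesis Lpos : positive_functional L.
Variable P : probability (clopen_sigma K) R.
Hypothesis PE : forall A : set K, clopen A -> P A = (L \1_A)%:E.

Let measurable_clopen (A : set (clopen_sigma K)) : clopen (A : set K) ->
  measurable A.
Proof. by move=> cA; exact: sub_sigma_algebra. Qed.

(** The integral and [L] are compared on every clopen piece, not only on the whole space, so that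
    the property survives changes on a clopen set. *)
Let good (s : K -> R) := [/\ bounded_real s,
  measurable_fun setT (s : clopen_sigma K -> R) & forall C : set K, clopen C ->
  (\int[P]_x (s x * \1_C x))%R = L (fun x => s x * \1_C x)].

Let good0 : good (fun=> 0).
Proof.
have [_ LZ _ _] := Lpos.
split; [exact: bounded_real_cst|exact: measurable_cst|move=> C cC].
rewrite LZ; last exact: bounded_real_indic.
rewrite mul0r; under eq_Rintegral do rewrite mul0r.
by rewrite Rintegral_cst // mul0r.
Qed.

(** The new function equals [a] on [C] and [s] elsewhere. Its restriction to [D] combines the
    restrictions of [s] to [D] and to [C] intersected with [D] and a multiple of an indicator, and
    on each of these the two functionals agree. *)
Let good_patch s (C : set K) (a : R) : clopen C -> good s ->
  good (fun x => s x + \1_C x * (a - s x)).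
Proof.
move=> cC [bs ms gs]; have [LD LZ _ _] := Lpos.
have mind (A : set K) : clopen A -> measurable_fun setT (\1_A : clopen_sigma K -> R).
  by move=> cA; apply: measurable_indic; exact: measurable_clopen.
split.
- apply: bounded_real_add => //; apply: bounded_real_mul; first exact: bounded_real_indic.
  apply: bounded_real_add; first exact: bounded_real_cst.
  by have [M sM] := bs; exists M => x; rewrite normrN.
- apply: measurable_funD => //; apply: measurable_funM; first exact: mind.
  by apply: measurable_funB => //; exact: measurable_cst.
- move=> D cD; have cCD : clopen (C `&` D) by exact: clopenI.
  have -> : (fun x => (s x + \1_C x * (a - s x)) * \1_D x) =
      (fun x => s x * \1_D x + (a * \1_(C `&` D) x + -1 * (s x * \1_(C `&` D) x))).
    apply/funext => x; rewrite !indicE in_setI.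
    by case: (x \in C); case: (x \in D); rewrite /= ?(mulr1, mulr0, mul1r, mul0r); lra.
  have bsD : bounded_real (fun x => s x * \1_D x).
    by apply: bounded_real_mul => //; exact: bounded_real_indic.
  have bsCD : bounded_real (fun x => s x * \1_(C `&` D) x).
    by apply: bounded_real_mul => //; exact: bounded_real_indic.
  have baCD : bounded_real (fun x => a * \1_(C `&` D) x).
    by apply: bounded_real_mul; [exact: bounded_real_cst|exact: bounded_real_indic].
  have bnCD : bounded_real (fun x => -1 * (s x * \1_(C `&` D) x)).
    by apply: bounded_real_mul => //; exact: bounded_real_cst.
  rewrite LD ?LD ?LZ //; [|exact: bounded_real_indic|exact: bounded_real_add].
  have msE E : clopen E -> measurable_fun setT (fun x : clopen_sigma K => s x * \1_E x).
    by move=> cE; apply: measurable_funM => //; exact: mind.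
  have maCD : measurable_fun setT (fun x : clopen_sigma K => a * \1_(C `&` D) x).
    by apply: measurable_funM; [exact: measurable_cst|exact: mind].
  have mnCD : measurable_fun setT
      (fun x : clopen_sigma K => -1 * (s x * \1_(C `&` D) x)).
    by apply: measurable_funM; [exact: measurable_cst|exact: msE].
  rewrite RintegralD //; last 2 first.
  - by apply: bounded_integrable => //; exact: msE.
  - by apply: bounded_integrable; [exact: measurable_funD|exact: bounded_real_add].
  rewrite RintegralD //; [|exact: bounded_integrable..].
  have iind : P.-integrable setT (EFin \o \1_(C `&` D)).
    by apply: bounded_integrable; [exact: mind|exact: bounded_real_indic].
  have isCD : P.-integrable setT (EFin \o (fun x => s x * \1_(C `&` D) x)).
    by apply: bounded_integrable => //; exact: msE.
  rewrite (RintegralZl a measurableT iind) (RintegralZl (-1) measurableT isCD).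
  rewrite !gs // Rintegral_indicT ?PE //.
  exact: measurable_clopen.
Qed.

(** Every point has a clopen neighbourhood on which [h] stays within [e] of its value there.
    Finitely many of these cover [K], and patching along them one after the other avoids making them
    disjoint. *)
Let step_approximation (h : K -> R) (e : R) : continuous h -> 0 < e ->
  exists2 s, good s & forall x, `|h x - s x| <= e.
Proof.
move=> ch e0.
have /choice[C CP] x : exists C : set K, [/\ clopen C, C x &
    forall y, C y -> `|h y - h x| <= e].
  have hx : nbhs x [set y | `|h y - h x| <= e].
    have := ch x; move=> /cvgrPdist_le/(_ _ e0); apply: filterS => y /=.
    by rewrite distrC.
  have [D [Dx cD] De] := zero_dimensional_cvg hausK zdK cptK hx.
  by exists D.
have cov : cover_compact [set: K] by rewrite -compact_cover.
have [D _ DT] : finite_subset_cover [set: K] C [set: K].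
  apply: (cov K setT C) => [x _|x _]; first by have [[]] := CP x.
  by exists x => //; have [] := CP x.
(* Induction on the list of centres: the approximation holds on the union of the neighbourhoods
   listed so far. *)
suff H (r : seq K) : exists2 s, good s &
    forall x y, y \in r -> C y x -> `|h x - s x| <= e.
  have [s gs hs] := H (enum_fset D); exists s => // x.
  by have [y yD Cyx] := DT x I; exact: hs yD Cyx.
elim: r => [|y r [s gs hs]]; first by exists (fun=> 0).
have [cCy Cyy hCy] := CP y.
exists (fun x => s x + \1_(C y) x * (h y - s x)); first exact: good_patch.
move=> x z; rewrite inE indicE; have [/set_mem Cyx _ _|nCyx] := boolP (x \in C y).
  by rewrite mul1r [s x + _]addrC subrK; exact: hCy.
rewrite mul0r addr0 => /orP[/eqP-> Czx|zr]; last exact: hs zr.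
by rewrite mem_set in nCyx.
Qed.

Lemma continuous_bounded (h : K -> R) : continuous h -> bounded_real h.
Proof.
move=> ch; have /compact_bounded[M [_ hM]] :=
  continuous_compact (continuous_subspaceT ch) cptK.
by exists (M + 1) => x; apply: (hM (M + 1)); [rewrite ltrDl|exists x].
Qed.

Lemma continuous_clopen_measurable (h : K -> R) : continuous h ->
  measurable_fun setT (h : clopen_sigma K -> R).
Proof.
move=> ch.
have /choice[s sP] (n : nat) : exists s, good s /\ forall x, `|h x - s x| <= n.+1%:R^-1.
  by have [|s] := step_approximation ch (_ : 0 < n.+1%:R^-1) => //; exists s.
apply: (@measurable_fun_cvg _ _ _ _ (s : nat -> clopen_sigma K -> R)).
  by move=> n; have [[]] := sP n.
move=> x _; apply/cvgrPdist_le => e e0; near=> n.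
apply: le_trans ((sP n).2 x) (ltW _); near: n.
exact: near_infty_natSinv_lt (PosNum e0).
Unshelve. all: by end_near. Qed.

(** Both sides are monotone and normalized, so each is within [e / 2] of its value at a step
    function uniformly close to [h], and these two values coincide. *)
Lemma riesz_representation (h : K -> R) : continuous h ->
  (\int[P]_x (h x))%R = L h.
Proof.
move=> ch; have bh := continuous_bounded ch; have [LD LZ _ L1] := Lpos.
have mh := continuous_clopen_measurable ch.
apply/eqP; rewrite -subr_eq0 -normr_le0; apply/ler_addgt0Pr => e e0.
have e2 : 0 < e / 2 by rewrite divr_gt0.
have [s [bs ms gs] hs] := step_approximation ch e2.
have {gs}Ls : (\int[P]_x s x)%R = L s.
  have := gs setT clopenT.
  rewrite indicT (_ : (fun x => s x * cst 1 x) = s) //.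
  by apply/funext => x; rewrite mulr1.
have h_le x : h x <= s x + e / 2.
  by have := hs x; rewrite ler_norml => /andP[]; lra.
have s_le x : s x <= h x + e / 2.
  by have := hs x; rewrite ler_norml => /andP[]; lra.
have Lcst : L (fun=> e / 2) = e / 2.
  transitivity (L (fun x => e / 2 * 1)).
    by congr L; apply/funext => x; rewrite mulr1.
  by rewrite LZ ?L1 ?mulr1 //; exact: bounded_real_cst.
have LDe f g : bounded_real f -> bounded_real g -> (forall x, f x <= g x + e / 2) ->
    L f <= L g + e / 2.
  move=> bf bg fg; rewrite -Lcst -LD //; last exact: bounded_real_cst.
  apply: positive_functional_le => //.
  by apply: bounded_real_add => //; exact: bounded_real_cst.
have := LDe _ _ bh bs h_le; have := LDe _ _ bs bh s_le.
have := @Rintegral_le_add _ _ _ P h s (e / 2) mh bh ms bs h_le.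
have := @Rintegral_le_add _ _ _ P s h (e / 2) ms bs mh bh s_le.
by rewrite Ls add0r ler_norml => *; apply/andP; split; lra.
Qed.

End riesz.

(** * Positive extension of functionals *)

Section hahn_banach_bounded.
Context {R : realType} {T : Type}.

Definition bounded_pred : {pred T -> R} := fun f => `[< bounded_real f >].

Lemma bounded_pred_submod_closed : submod_closed bounded_pred.
Proof.
split; first by apply/asboolP; exact: bounded_real_cst.
move=> a f g /asboolP bf /asboolP bg; apply/asboolP; apply: bounded_real_add => //.
by apply: bounded_real_mul => //; exact: bounded_real_cst.
Qed.

HB.instance Definition _ :=
  GRing.isSubmodClosed.Build R (T -> R) bounded_pred bounded_pred_submod_closed.

(** Bundles the bounded functions into a module over [R], as [hahn_banach] requires. *)
Record bounded_function :=
  BoundedFunction { bounded_val :> T -> R; _ : bounded_val \in bounded_pred }.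
HB.instance Definition _ := [isSub for bounded_val].
HB.instance Definition _ := [Choice of bounded_function by <:].
HB.instance Definition _ := [SubChoice_isSubLmodule of bounded_function by <:].

Lemma hahn_banach_bounded (p : (T -> R) -> R) (v : T -> R) : bounded_real v ->
  (forall f g, bounded_real f -> bounded_real g ->
     p (fun x => f x + g x) <= p f + p g) ->
  (forall (a : R) f, bounded_real f -> 0 <= a -> p (fun x => a * f x) = a * p f) ->
  exists L : (T -> R) -> R, [/\
    forall f g, bounded_real f -> bounded_real g ->
      L (fun x => f x + g x) = L f + L g,
    forall (a : R) f, bounded_real f -> L (fun x => a * f x) = a * L f,
    forall f, bounded_real f -> L f <= p f & L v = p v].
Proof.
move=> bv pD pZ.
have bP (f : bounded_function) : bounded_real f by apply/asboolP; exact: (valP f).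
have sp : sublinear (fun f : bounded_function => p f).
  by split => [f g|a f a0]; [exact: pD|exact: pZ].
have inb f : bounded_real f -> f \in bounded_pred by move=> ?; exact/asboolP.
have [L [LD LZ Lp Lv]] := hahn_banach (BoundedFunction (inb _ bv)) sp.
(* On unbounded functions [insubd] returns its default 0; the four claims concern bounded functions
   only. *)
exists (fun f => L (insubd 0 f)).
have inE f (bf : bounded_real f) : insubd 0 f = BoundedFunction (inb _ bf).
  by apply: val_inj; rewrite val_insubd inb.
split.
- move=> f g bf bg; rewrite (inE _ bf) (inE _ bg) -LD.
  by rewrite (inE _ (bounded_real_add bf bg)); congr L; exact: val_inj.
- move=> a f bf; rewrite (inE _ bf) -LZ.
  rewrite (inE _ (bounded_real_mul (bounded_real_cst a) bf)).
  by congr L; exact: val_inj.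
- by move=> f bf; rewrite (inE _ bf); exact: Lp.
- by rewrite (inE _ bv) Lv.
Qed.

End hahn_banach_bounded.

(* [G g l] prescribes the value [l] of the functional at [g]. *)
Lemma positive_extension (R : realType) (T : Type) (G : (T -> R) -> R -> Prop)
    (C : T -> R) : bounded_real C ->
  (forall g l, G g l -> bounded_real g) ->
  (forall g l g' l', G g l -> G g' l' -> G (fun x => g x + g' x) (l + l')) ->
  (forall (a : R) g l, G g l -> G (fun x => a * g x) (a * l)) ->
  G (fun=> 1) 1 ->
  (forall g l, G g l -> (forall x, 0 <= g x) -> 0 <= l) ->
  exists L, [/\ positive_functional L, forall g l, G g l -> L g = l &
    forall e : R, 0 < e ->
      exists g l, [/\ G g l, forall x, g x <= C x & L C <= l + e]].
Proof.
move=> [M CM] Gb GD GZ G1 Gge0.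
have Gmono g l g' l' : G g l -> G g' l' -> (forall x, g x <= g' x) -> l <= l'.
  move=> Gg Gg' gg'; rewrite -subr_ge0 -mulN1r.
  by apply: Gge0 (GD _ _ _ _ Gg' (GZ (-1) _ _ Gg)) _ => x; rewrite mulN1r subr_ge0.
have Gcst a : G (fun=> a) a.
  have -> : (fun=> a) = (fun _ : T => a * 1) by apply/funext => x; rewrite mulr1.
  by rewrite -[X in G _ X]mulr1; exact: GZ.
(* The infimum [p h] of [E h] is a kind of upper integral of [h]. A linear functional below [p] is
   positive, and it takes the prescribed values because it is bounded by them at both [g] and
   [- g]. *)
pose E h := [set l | exists2 g, G g l & forall x, h x <= g x].
have E0 h : bounded_real h -> E h !=set0.
  by move=> [N hN]; exists N, (fun=> N) => // x; exact: le_trans (ler_norm _) (hN x).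
have Elb h : bounded_real h -> has_lbound (E h).
  move=> [N hN]; exists (- N) => l [g Gg hg].
  apply: Gmono (Gcst (- N)) Gg _ => x; apply: le_trans (hg x).
  by have := hN x; rewrite ler_norml => /andP[].
pose p h := inf (E h).
have p_le h g l : bounded_real h -> G g l -> (forall x, h x <= g x) -> p h <= l.
  by move=> bh Gg hg; apply: (ge_inf (Elb h bh)); exists g.
have p_ge h m : bounded_real h ->
    (forall g l, G g l -> (forall x, h x <= g x) -> m <= l) -> m <= p h.
  by move=> bh mE; apply: (lb_le_inf (E0 h bh)) => l [g Gg hg]; exact: mE Gg hg.
have bZ (a : R) f : bounded_real f -> bounded_real (fun x : T => a * f x).
  by move=> bf; apply: bounded_real_mul => //; exact: bounded_real_cst.
have pD f g : bounded_real f -> bounded_real g ->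
    p (fun x => f x + g x) <= p f + p g.
  move=> bf bg; rewrite -lerBlDr; apply: (p_ge f) => // k l Gk fk.
  rewrite lerBlDr -lerBlDl; apply: (p_ge g) => // k' l' Gk' gk'.
  rewrite lerBlDl; apply: p_le (GD _ _ _ _ Gk Gk') _; first exact: bounded_real_add.
  by move=> x; apply: lerD.
have pZ a f : bounded_real f -> 0 <= a -> p (fun x => a * f x) = a * p f.
  move=> bf; rewrite le_eqVlt => /predU1P[<-|a0].
    rewrite mul0r (_ : (fun x => 0 * f x) = (fun=> 0)); last first.
      by apply/funext => x; rewrite mul0r.
    apply/eqP; rewrite eq_le; apply/andP; split.
      by apply: p_le (Gcst 0) _ => //; exact: bounded_real_cst.
    by apply: p_ge => [|g l Gg g0]; [exact: bounded_real_cst|exact: Gge0 Gg g0].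
  apply/eqP; rewrite eq_le; apply/andP; split.
    rewrite mulrC -ler_pdivrMr //; apply: (p_ge f) => // g l Gg fg.
    rewrite ler_pdivrMr // mulrC; apply: p_le (GZ a _ _ Gg) _; first exact: bZ.
    by move=> x; rewrite ler_pM2l.
  apply: p_ge; first exact: bZ.
  move=> g l Gg fg; rewrite mulrC -ler_pdivlMr // mulrC.
  by apply: p_le (GZ a^-1 _ _ Gg) _ => // x; rewrite ler_pdivlMl.
have bNC : bounded_real (fun x => - C x) by exists M => x; rewrite normrN.
(* Equality with [p] is requested at [- C], which makes [L C] the supremum of the prescribed values
   of functions below [C]. *)
have [L [LD LZ Lp LC]] := hahn_banach_bounded bNC pD pZ.
have LG g l : G g l -> L g = l.
  move=> Gg; have bg := Gb _ _ Gg; apply/eqP; rewrite eq_le; apply/andP; split.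
    by apply: le_trans (Lp _ bg) _; exact: p_le Gg _.
  rewrite -lerN2 -mulN1r -(mulN1r l) -LZ //.
  apply: le_trans (Lp _ (bZ _ _ bg)) _; apply: p_le (GZ (-1) _ _ Gg) _ => //.
  exact: bZ.
exists L; split => //.
  split => //; last exact: LG.
  move=> f bf f0; rewrite -oppr_le0 -mulN1r -LZ //.
  apply: le_trans (Lp _ (bZ _ _ bf)) _; apply: p_le (Gcst 0) _; first exact: bZ.
  by move=> x; rewrite mulN1r oppr_le0.
move=> e e0; have [l [g Gg gC] le] := inf_adherent e0 (conj (E0 _ bNC) (Elb _ bNC)).
exists (fun x => -1 * g x), (-1 * l); split; first exact: GZ.
- by move=> x; rewrite mulN1r lerNl.
- have := LZ (-1) _ bNC; rewrite LC (_ : (fun x => -1 * - C x) = C); last first.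
    by apply/funext => x; rewrite mulN1r opprK.
  by move: le; rewrite -/(p _) => + ->; lra.
Qed.

(** * Borel measures and continuous functions *)

Section borel_continuous.
Context {R : realType} {Y : pseudoPMetricType R}.

Lemma continuous_borel_measurable (f : Y -> R) : continuous f ->
  measurable_fun setT (f : borel Y -> R).
Proof.
move=> cf; apply: (measurability _ (RGenOInfty.measurableE R)).
move=> _ [_ [a ->] <-]; rewrite setTI; apply: sub_sigma_algebra.
by apply: (open_comp (fun x _ => cf x)); exact: interval_open.
Qed.

(** The distance to the complement of [U] works, except that it is [+oo] when [U] is the whole
    space; [contract] makes it real and preserves its sign. *)
Lemma open_positivity (U : set Y) : open U ->
  exists f : Y -> R, [/\ continuous f, forall x, 0 <= f x & forall x, U x <-> 0 < f x].
Proof.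
move=> oU; pose f x : R := contract (edist_inf (~` U) x).
have f0 x : 0 <= f x by rewrite -(@contract0 R) le_contract; exact: edist_inf_ge0.
exists f; split => // [x|x].
  apply/cvgrPdist_lt => e e0.
  have := @edist_inf_continuous R Y (~` U) x; move=> /cvg_ballP/(_ _ e0).
  by apply: filterS => y; rewrite /ball /= /ereal_ball.
split=> [Ux|fx]; last first.
  apply: contrapT => nUx; move: fx.
  by rewrite /f (edist_inf0 nUx) contract0 ltxx.
have /nbhs_ballP[e /= e0 xeU] : nbhs x U by exact: open_nbhs_nbhs.
rewrite -(@contract0 R) lt_contract; apply: (@lt_le_trans _ _ e%:E); first by rewrite lte_fin.
apply: le_ereal_inf_tmp => _ [y nUy <-].
rewrite leNgt; apply/negP => /edist_lt_ball xy.
by apply: nUy; apply: xeU; exact: xy.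
Qed.

(** The open sets form a generating class stable under intersection, so it suffices to compare the
    measures on an open [U]. With [f] positive exactly on [U], the functions
    [Num.min 1 (j%:R * f x)] increase to the indicator of [U], and monotone convergence applies. *)
Lemma borel_measure_ext (m1 m2 : {measure set (borel Y) -> \bar R}) :
  (m1 setT < +oo)%E ->
  (forall f : Y -> R, continuous f -> (forall x, 0 <= f x)%R ->
    \int[m1]_x (f x)%:E = \int[m2]_x (f x)%:E)%E ->
  forall A, measurable A -> m1 A = m2 A.
Proof.
move=> m1oo m12; apply: (@measure_unique _ R (borel Y) (@open Y) (fun=> setT)) => //.
- exact: openI.
- by move=> _; exact: openT.
- by rewrite bigcup_const //; exists 0%N.
move=> U oU; have [f [cf f0 Uf]] := open_positivity oU.
pose g (j : nat) x : R := Num.min 1 (j%:R * f x).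
have cg j : continuous (g j).
  move=> x; apply: (@continuous_min R Y (cst 1) (fun x => j%:R * f x)).
    exact: cvg_cst.
  by apply: cvgM; [exact: cvg_cst|exact: cf].
have g0 j x : 0 <= g j x by rewrite /g le_min ler01 mulr_ge0.
have gcvg (m : {measure set (borel Y) -> \bar R}) :
    (\int[m]_x (g n x)%:E @[n --> \oo] --> m U)%E.
  have -> : m U = (\int[m]_x limn (fun n => (g n x)%:E))%E.
    rewrite -[U in LHS]setIT -integral_indic //; last exact: sub_sigma_algebra.
    apply: eq_integral => x _; apply/esym/cvg_lim => //.
    rewrite indicE; have [/set_mem Ux|nUx] := boolP (x \in U).
      apply: cvg_near_cst; near=> n; congr _%:E; apply/min_idPl.
      have fx : 0 < f x by exact/Uf.
      rewrite -ler_pdivrMr //; near: n; exact: nbhs_infty_ger.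
    have fx : f x = 0.
      apply/eqP; rewrite eq_le f0 andbT leNgt; apply/negP => /Uf.
      by move/mem_set => Ux; rewrite Ux in nUx.
    apply: cvg_near_cst; near=> n; rewrite /g fx mulr0.
    by congr _%:E; apply/min_idPr.
  apply: cvg_monotone_convergence => //.
  - by move=> n; apply/measurable_EFinP; exact: continuous_borel_measurable.
  - by move=> n x _; rewrite lee_fin.
  - move=> x _ n k nk; rewrite lee_fin /g le_min ge_min lexx /=.
    by rewrite ge_min ler_wpM2r ?orbT // ler_nat.
have h1 := gcvg m1; have h2 := gcvg m2.
rewrite (_ : (fun n => _) = (fun n => \int[m1]_x (g n x)%:E)%E) in h2; last first.
  by apply/funext => n; rewrite m12.
exact: cvg_unique h1 h2.
Unshelve. all: by end_near. Qed.

End borel_continuous.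

(** The preimage of an open set is the positivity set of a continuous real function on [K], and such
    functions are limits of clopen step functions. *)
Lemma continuous_clopen_borel (R : realType) (K : ptopologicalType)
    (Y : pseudoPMetricType R) (u : K -> Y) :
  compact [set: K] -> hausdorff_space K -> zero_dimensional K ->
  continuous u -> measurable_fun setT (u : clopen_sigma K -> borel Y).
Proof.
move=> cK hK zK cu; apply: (@measurability _ _ _ (borel Y) _ _ (@open Y)) => //.
move=> _ [U oU <-]; rewrite setTI.
have [f [cf _ Uf]] := open_positivity oU.
have cfu : continuous (f \o u) by move=> x; apply: continuous_comp; [exact: cu|exact: cf].
have mfu : measurable_fun setT (f \o u : clopen_sigma K -> R).
  (* The evaluation at a point only serves to instantiate a lemma whose
     conclusion does not depend on the functional. *)
  have dpos : positive_functional (fun h : K -> R => h point) by split.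
  exact: (continuous_clopen_measurable cK hK zK dpos (P := \d_point)).
have := mfu measurableT `]0, +oo[%classic (measurable_itv _); rewrite setTI.
congr (measurable _); apply/seteqP; split => x /=; rewrite in_itv /= andbT;
  by move/Uf.
Qed.

Lemma pushforward_probability d d' (T : measurableType d) (T' : measurableType d')
    (R : realType) (P : probability T R) (u : T -> T') :
  measurable_fun setT u ->
  exists Q : probability T' R, (forall A, Q A = P (u @^-1` A)) /\
    forall f : T' -> R, measurable_fun setT f -> bounded_real f ->
      (\int[Q]_y f y = \int[P]_x f (u x))%R.
Proof.
move=> mu; pose U : {mfun T >-> T'} := HB.pack u (isMeasurableFun.Build _ _ _ _ u mu).
exists (distribution P U); split => // f mf bf; congr fine.
rewrite [LHS](@integral_pushforward _ _ _ _ _ u mu P setT (EFin \o f)) //.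
  exact/measurable_EFinP.
apply: bounded_integrable; first exact: measurableT_comp.
by have [M fM] := bf; exists M => x.
Qed.

(** * Integrals of continuous functions on a compact space *)

Section compact_integration.
Context {R : realType} {Y : pseudoPMetricType R}.
Hypothesis cptY : compact [set: Y].
Implicit Types (f : Y -> R) (m : probability (borel Y) R).

Lemma continuous_integrable m f : continuous f -> m.-integrable setT (EFin \o f).
Proof.
move=> cf; apply: bounded_integrable; first exact: continuous_borel_measurable.
exact: continuous_bounded cptY f cf.
Qed.

Lemma EFin_Rintegral m f : continuous f ->
  ((\int[m]_x f x)%R%:E = \int[m]_x (f x)%:E)%E.
Proof.
move=> cf; rewrite fineK //; apply: integrable_fin_num => //.
exact: continuous_integrable.
Qed.

Lemma Rintegral_continuousD m f g : continuous f -> continuous g ->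
  (\int[m]_x (f x + g x) = \int[m]_x f x + \int[m]_x g x)%R.
Proof. by move=> cf cg; rewrite RintegralD //; exact: continuous_integrable. Qed.

Lemma Rintegral_continuousB m f g : continuous f -> continuous g ->
  (\int[m]_x (f x - g x) = \int[m]_x f x - \int[m]_x g x)%R.
Proof. by move=> cf cg; rewrite RintegralB //; exact: continuous_integrable. Qed.

Lemma Rintegral_continuousZ m (a : R) f : continuous f ->
  (\int[m]_x (a * f x) = a * \int[m]_x f x)%R.
Proof. by move=> cf; rewrite RintegralZl //; exact: continuous_integrable. Qed.

Lemma Rintegral_probability_cst m (a : R) : (\int[m]_x a = a)%R.
Proof.
have mT : fine (m setT) = 1 by rewrite probability_setT.
by rewrite Rintegral_cst // mT mulr1.
Qed.

Lemma le_Rintegral_continuous m f g : continuous f -> continuous g ->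
  (forall x, f x <= g x) -> (\int[m]_x f x <= \int[m]_x g x)%R.
Proof.
by move=> cf cg fg; apply: le_Rintegral => //; exact: continuous_integrable.
Qed.

Lemma borel_probability_ext m1 m2 :
  (forall f, continuous f -> (\int[m1]_x f x = \int[m2]_x f x)%R) ->
  forall A, measurable A -> m1 A = m2 A.
Proof.
move=> m12; apply: borel_measure_ext => [|f cf _].
  exact: le_lt_trans (probability_le1 m1 measurableT) (ltry 1).
by rewrite -!EFin_Rintegral // m12.
Qed.

Lemma sum_measureP (rho : nat -> probability (borel Y) R)
    (lambda : probability (borel Y) R) (n : nat) :
  (forall A : set (borel Y), measurable A ->
    (\sum_(1 <= i < n.+1) rho i A = n%:R%:E * lambda A)%E) <->
  (forall f, continuous f ->
    \sum_(1 <= i < n.+1) (\int[rho i]_x f x)%R = n%:R * (\int[lambda]_x f x)%R).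
Proof.
pose ms := msum (fun i => rho i.+1 : {measure set (borel Y) -> \bar R}) n.
pose ml := mscale (NngNum (ler0n R n)) lambda.
have msE A : ms A = (\sum_(1 <= i < n.+1) rho i A)%E.
  by rewrite big_add1 big_mkord.
have int_ms f : continuous f -> (forall x, 0 <= f x) ->
    (\int[ms]_x (f x)%:E)%E = (\sum_(1 <= i < n.+1) (\int[rho i]_x f x)%R)%:E.
  move=> cf f0; rewrite ge0_integral_measure_sum //; last 2 first.
  - by move=> x _; rewrite lee_fin.
  - by apply/measurable_EFinP; exact: continuous_borel_measurable.
  rewrite big_add1 big_mkord -sumEFin; apply: eq_bigr => i _.
  by rewrite EFin_Rintegral.
have int_ml f : continuous f -> (forall x, 0 <= f x) ->
    (\int[ml]_x (f x)%:E)%E = (n%:R * (\int[lambda]_x f x)%R)%:E.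
  move=> cf f0; rewrite ge0_integral_mscale //; last 2 first.
  - by apply/measurable_EFinP; exact: continuous_borel_measurable.
  - by move=> x _; rewrite lee_fin.
  by rewrite EFinM EFin_Rintegral.
split=> [sA f cf|sf A mA].
  (* Integrals against [ms] and [ml] are computed for nonnegative functions, so [f] is raised by a
     bound [M]; both sides then gain [n%:R * M], which cancels. *)
  have [M fM] := continuous_bounded cptY cf.
  have cfM : continuous (fun x => f x + M).
    by move=> x; apply: cvgD; [exact: cf|exact: cvg_cst].
  have fM0 x : 0 <= f x + M by have := fM x; rewrite ler_norml; lra.
  have : (\int[ms]_x (f x + M)%:E = \int[ml]_x (f x + M)%:E)%E.
    apply: eq_measure_integral => A mA _.
    by transitivity (\sum_(1 <= i < n.+1) rho i A)%E; [exact: msE|exact: sA].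
  rewrite int_ms // int_ml // => -[].
  have shift (m : probability (borel Y) R) :
      (\int[m]_x (f x + M) = \int[m]_x f x + M)%R.
    rewrite Rintegral_continuousD //; last exact: cst_continuous.
    by rewrite Rintegral_probability_cst.
  rewrite shift; under eq_bigr do rewrite shift.
  rewrite big_split /= sumr_const_nat subSS subn0 mulrDr (mulr_natl M n).
  exact: addIr.
have msT : (ms setT < +oo)%E.
  rewrite msE; apply: lte_sum_pinfty => i _.
  exact: le_lt_trans (probability_le1 (rho i) measurableT) (ltry 1).
rewrite -msE; apply: (@borel_measure_ext R Y ms ml msT) => // f cf f0.
by rewrite int_ms // int_ml // sf.
Qed.

End compact_integration.

(** * Chains of measures with cost at most the dual value *)

Definition cantor_sequence : Type := prod_topology (fun _ : nat => cantor_space).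
HB.instance Definition _ := Pointed.on cantor_sequence.
HB.instance Definition _ := Topological.on cantor_sequence.

Lemma continuous_sum (R : realType) (T : topologicalType) (a b : nat)
    (F : nat -> T -> R) :
  (forall i, continuous (F i)) -> continuous (fun t => \sum_(a <= i < b) F i t).
Proof.
move=> cF; apply: (@continuous_big R nat +%R 0 xpredT) => // y.
by apply: (@cvgD R R (R * R)%type); [exact: cvg_fst|exact: cvg_snd].
Qed.

Lemma continuous_add (R : realType) (T : topologicalType) (f g : T -> R) :
  continuous f -> continuous g -> continuous (fun t => f t + g t).
Proof. by move=> cf cg t; apply: cvgD; [exact: cf|exact: cg]. Qed.

Lemma continuous_scale (R : realType) (T : topologicalType) (a : R) (f : T -> R) :
  continuous f -> continuous (fun t => a * f t).
Proof. by move=> cf t; apply: cvgM; [exact: cvg_cst|exact: cf]. Qed.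

Section chain_duality.
Context {R : realType} {X : pMetricType R}.
Hypothesis cptX : compact [set: X].
Variables (mu nu lambda : probability (borel X) R) (n : nat).

Definition chain_test (phi psi f : X -> R) (x : nat -> X) : R :=
  phi (x 0%N) + psi (x n.+1) + \sum_(1 <= i < n.+1) f (x i).

Definition chain_dual_value (phi psi f : X -> R) : R :=
  (\int[mu]_x phi x + \int[nu]_x psi x + n%:R * \int[lambda]_x f x)%R.

(** Every integral is at least the minimum of its integrand. The three minima occur together along
    one chain: it starts at a minimizer of [phi], ends at one of [psi], and rests at one of [f] in
    between. *)
Lemma chain_dual_value_ge0 phi psi f :
  continuous phi -> continuous psi -> continuous f ->
  (forall x, 0 <= chain_test phi psi f x) -> 0 <= chain_dual_value phi psi f.
Proof.
move=> cphi cpsi cf test0.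
have min_int (g : X -> R) : continuous g -> exists a, forall m : probability (borel X) R,
    g a <= (\int[m]_x g x)%R.
  move=> cg; have XX : [set: X] !=set0 by exists point.
  have [a _ amin] := compact_EVT_min XX cptX (continuous_subspaceT cg).
  exists a => m; rewrite -[leLHS](Rintegral_probability_cst m).
  apply: le_Rintegral_continuous => //; first exact: cst_continuous.
  by move=> x; apply: amin; exact: mem_set.
have [a phia] := min_int _ cphi; have [b psib] := min_int _ cpsi.
have [d fd] := min_int _ cf.
pose x i := if i == 0%N then a else if i == n.+1 then b else d.
apply: le_trans (test0 x) _; rewrite /chain_test /chain_dual_value.
rewrite /x /= eqxx; apply: lerD; first exact: lerD.
rewrite (eq_big_nat _ _ (F2 := fun=> f d)); last first.
  by move=> i /andP[i1 iN]; rewrite gtn_eqF // ltn_eqF.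
rewrite sumr_const_nat subSS subn0 -[_ *+ n in leLHS]mulr_natl.
by apply: ler_wpM2l.
Qed.

Let K := cantor_sequence.

Let cptK : compact [set: K].
Proof.
have := @tychonoff nat (fun=> cantor_space) (fun=> setT) (fun=> cantor_space_compact).
by congr (compact _); rewrite eqEsubset.
Qed.

Let hausK : hausdorff_space K.
Proof. by apply: hausdorff_product => _; exact: cantor_space_hausdorff. Qed.

Let zdK : zero_dimensional K.
Proof. by apply: zero_dimension_prod => _; exact: cantor_zero_dimensional. Qed.

(** The [pi i] are the joint laws of consecutive points under one measure on sequences, so
    neighbouring couplings share a marginal. All measures are chosen before [e], which is why the
    minimum is attained in the end. *)
Lemma chain_duality (c : X * X -> R) : continuous c ->
  exists (rho : nat -> probability (borel X) R)
    (pi : nat -> probability (borel (X * X)%type) R),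
  [/\ rho 0%N = mu, rho n.+1 = nu,
      forall A : set (borel X), measurable A ->
        (\sum_(1 <= i < n.+1) rho i A = n%:R%:E * lambda A)%E,
      forall i, coupling (rho i) (rho i.+1) (pi i) &
      forall e : R, 0 < e -> exists phi psi f, [/\
        [/\ continuous phi, continuous psi & continuous f],
        forall x : nat -> X,
          chain_test phi psi f x <= \sum_(0 <= i < n.+1) c (x i, x i.+1) &
        \sum_(0 <= i < n.+1) (\int[pi i]_z c z)%R
          <= chain_dual_value phi psi f + e]].
Proof.
move=> cc.
have [q cq] := cantor_surj cptX (@metric_hausdorff R X).
pose u i (w : K) : X := q (w i).
have cu i : continuous (u i).
  move=> w; apply: continuous_comp; last exact: cq.
  exact: (@proj_continuous nat (fun=> cantor_space) i).
have cuu i : continuous (fun w => (u i w, u i.+1 w)).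
  move=> w; exact: (@cvg_pair K X X (nbhs w) (nbhs (u i w)) (nbhs (u i.+1 w))
    _ _ _ (u i) (u i.+1) (cu i w) (cu i.+1 w)).
(* Since every chain has a parameter, an inequality valid on all of [K] holds for all chains. *)
have u_surj (x : nat -> X) : exists w : K, forall i, u i w = x i.
  have /choice[w wx] i : exists v, q v = x i.
    by have [v _ <-] := @surj _ _ _ _ q (x i) I; exists v.
  by exists w.
have bK (h : K -> R) : continuous h -> bounded_real h by exact: continuous_bounded.
pose chain_cost w := \sum_(0 <= i < n.+1) c (u i w, u i.+1 w).
have ccost_i i : continuous (fun w => c (u i w, u i.+1 w)).
  by move=> w; apply: continuous_comp; [exact: cuu|exact: cc].
have ccost : continuous chain_cost by exact: continuous_sum.
have cfu (f : X -> R) i : continuous f -> continuous (fun w => f (u i w)).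
  by move=> cf w; apply: continuous_comp; [exact: cu|exact: cf].
pose G g l := exists phi psi f, [/\
  [/\ continuous phi, continuous psi & continuous f],
  g = (fun w => chain_test phi psi f (u^~ w)) & l = chain_dual_value phi psi f].
have Gcont g l : G g l -> continuous g.
  move=> [phi [psi [f [[cphi cpsi cf] -> _]]]].
  apply: continuous_add; first by apply: continuous_add; exact: cfu.
  by apply: continuous_sum => i; exact: cfu.
have GD g l g' l' : G g l -> G g' l' -> G (fun w => g w + g' w) (l + l').
  move=> [phi [psi [f [[cphi cpsi cf] -> ->]]]] [phi' [psi' [f' [[cphi' cpsi' cf'] -> ->]]]].
  exists (fun x => phi x + phi' x), (fun x => psi x + psi' x), (fun x => f x + f' x).
  split; first by split; exact: continuous_add.
    apply/funext => w; rewrite /chain_test big_split /=; lra.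
  rewrite /chain_dual_value !Rintegral_continuousD //; lra.
have GZ (a : R) g l : G g l -> G (fun w => a * g w) (a * l).
  move=> [phi [psi [f [[cphi cpsi cf] -> ->]]]].
  exists (fun x => a * phi x), (fun x => a * psi x), (fun x => a * f x).
  split; first by split; exact: continuous_scale.
    by apply/funext => w; rewrite /chain_test -mulr_sumr; lra.
  by rewrite /chain_dual_value !Rintegral_continuousZ //; lra.
have c0 (a : R) : continuous (fun _ : X => a) by exact: cst_continuous.
have G_end (phi psi : X -> R) : continuous phi -> continuous psi ->
    G (fun w => phi (u 0%N w) + psi (u n.+1 w)) (\int[mu]_x phi x + \int[nu]_x psi x)%R.
  move=> cphi cpsi; exists phi, psi, (fun=> 0); split => //.
    by apply/funext => w; rewrite /chain_test big1 // addr0.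
  by rewrite /chain_dual_value Rintegral_probability_cst mulr0 addr0.
have G_mid (f : X -> R) : continuous f ->
    G (fun w => \sum_(1 <= i < n.+1) f (u i w)) (n%:R * \int[lambda]_x f x)%R.
  move=> cf; exists (fun=> 0), (fun=> 0), f; split => //.
    by apply/funext => w; rewrite /chain_test !add0r.
  by rewrite /chain_dual_value !Rintegral_probability_cst !add0r.
have G1 : G (fun=> 1) 1.
  have := G_end (fun=> 1) (fun=> 0) (c0 _) (c0 _).
  rewrite !Rintegral_probability_cst addr0.
  by congr (G _ _); apply/funext => w; rewrite addr0.
have Gge0 g l : G g l -> (forall w, 0 <= g w) -> 0 <= l.
  move=> [phi [psi [f [[cphi cpsi cf] -> ->]]]] test0.
  apply: chain_dual_value_ge0 => // x; have [w wx] := u_surj x.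
  by have := test0 w; rewrite (_ : u^~ w = x) //; apply/funext.
have [L [Lpos LG LC]] := positive_extension (bK _ ccost)
  (fun g l Gg => bK _ (Gcont g l Gg)) GD GZ G1 Gge0.
have [P PE] := clopen_probability cptK Lpos.
have LE := riesz_representation cptK hausK zdK Lpos PE.
have /choice[Q QP] i := pushforward_probability P
  (continuous_clopen_borel cptK hausK zdK (cu i)).
have /choice[pi piP] i := pushforward_probability P
  (continuous_clopen_borel cptK hausK zdK (cuu i)).
have QE f i : continuous f -> (\int[Q i]_x f x)%R = L (fun w => f (u i w)).
  move=> cf; rewrite (QP i).2; last 2 first.
  - exact: continuous_borel_measurable.
  - exact: continuous_bounded cptX _ cf.
  by rewrite LE //; exact: cfu.
have Q0 A : measurable A -> Q 0%N A = mu A.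
  apply: (borel_probability_ext cptX) => // f cf; rewrite QE //.
  have := LG _ _ (G_end _ _ cf (c0 0)); rewrite Rintegral_probability_cst addr0 => <-.
  by congr L; apply/funext => w; rewrite addr0.
have Qn A : measurable A -> Q n.+1 A = nu A.
  apply: (borel_probability_ext cptX) => // f cf; rewrite QE //.
  have := LG _ _ (G_end _ _ (c0 0) cf); rewrite Rintegral_probability_cst add0r => <-.
  by congr L; apply/funext => w; rewrite add0r.
have L_sum (F : nat -> K -> R) a b : (forall i, continuous (F i)) ->
    L (fun w => \sum_(a <= i < b) F i w) = \sum_(a <= i < b) L (F i).
  have [LD LZ _ _] := Lpos.
  have L0 : L (fun=> 0) = 0.
    transitivity (L (fun=> 0 * 0)); first by congr L; apply/funext => w; rewrite mul0r.
    by rewrite LZ ?mul0r //; exact: bounded_real_cst.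
  move=> cF; elim: b => [|b IH].
    rewrite big_geq // -[RHS]L0; congr L.
    by apply/funext => w; rewrite big_geq.
  have [ab|ba] := leqP a b; last first.
    rewrite big_geq // -[RHS]L0; congr L.
    by apply/funext => w; rewrite big_geq.
  rewrite big_nat_recr //= -IH -LD; last 2 first.
  - by apply: bK; exact: continuous_sum.
  - exact: bK.
  by congr L; apply/funext => w; rewrite big_nat_recr.
have Qsum A : measurable A -> (\sum_(1 <= i < n.+1) Q i A = n%:R%:E * lambda A)%E.
  move: A; apply/(sum_measureP cptX) => f cf.
  rewrite -(LG _ _ (G_mid _ cf)) L_sum; last by move=> i; exact: cfu.
  by apply: eq_bigr => i _; exact: QE.
(* [Q] agrees with [mu] and [nu] at the ends on measurable sets only, whereas [rho 0%N = mu] and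
   [rho n.+1 = nu] are equalities of probabilities; hence the substitution. *)
pose rho i := if i == 0%N then mu else if i == n.+1 then nu else Q i.
have rhoE i A : measurable A -> rho i A = Q i A.
  move=> mA; rewrite /rho; case: eqP => [->|_]; first by rewrite Q0.
  by case: eqP => [->|_] //; rewrite Qn.
exists rho, pi; split.
- by rewrite /rho eqxx.
- by rewrite /rho /= eqxx.
- by move=> A mA; rewrite -Qsum //; apply: eq_bigr => i _; exact: rhoE.
- move=> i A mA; rewrite !rhoE // (QP i).1 (QP i.+1).1.
  by split; rewrite /pushforward (piP i).1.
move=> e e0; have [g [l [[phi [psi [f [cont gE lE]]]] gC Ll]]] := LC e e0.
exists phi, psi, f; split => //.
  move=> x; have [w wx] := u_surj x; have := gC w.
  rewrite gE /chain_cost (_ : u^~ w = x); last exact/funext.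
  by under [X in _ <= X -> _]eq_bigr do rewrite !wx.
rewrite -lE; apply: le_trans Ll; rewrite L_sum // le_eqVlt; apply/orP; left; apply/eqP.
apply: eq_bigr => i _; rewrite (piP i).2; last 2 first.
- exact: continuous_borel_measurable.
- by apply: continuous_bounded cc; rewrite -setXTT; exact: compact_setX.
by rewrite LE.
Qed.

End chain_duality.

(** * Continuity of infima *)

Section infimum_continuity.
Context {R : realType} {X : pMetricType R}.
Hypothesis cptX : compact [set: X].

(** By equicontinuity all members move by at most [e] near [z], and so does their infimum. *)
Lemma continuous_inf (Z : topologicalType) (I : Type) (F : I -> Z -> R) :
  (exists i : I, True) ->
  (forall z, has_lbound [set F i z | i in setT]) ->
  (forall z (e : R), 0 < e -> \forall z' \near z, forall i, `|F i z - F i z'| <= e) ->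
  continuous (fun z => inf [set F i z | i in setT]).
Proof.
move=> [i0 _] Flb Fequi z; apply/cvgrPdist_le => e e0.
have inf_le z1 z2 : (forall i, `|F i z1 - F i z2| <= e) ->
    inf [set F i z1 | i in setT] <= inf [set F i z2 | i in setT] + e.
  move=> F12; rewrite -lerBlDr; apply: lb_le_inf; first by exists (F i0 z2), i0.
  move=> _ [i _ <-]; rewrite lerBlDr.
  have : inf [set F i z1 | i in setT] <= F i z1 by apply: ge_inf => //; exists i.
  by have := F12 i; rewrite ler_norml => /andP[]; lra.
apply: filterS (Fequi z e e0) => z' Fzz'.
have Fz'z i : `|F i z' - F i z| <= e by rewrite distrC.
have := inf_le _ _ Fzz'; have := inf_le _ _ Fz'z.
by rewrite ler_norml => *; apply/andP; split; lra.
Qed.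

(** Continuity at each [(x, y)] gives a product neighbourhood, and compactness in [y] yields one
    neighbourhood of [x] for all [y]. The bound [e / 2] is used twice, since [(x, y')] and
    [(x', y')] are both compared with [(x, y)]. *)
Lemma equicontinuous_left (c : X * X -> R) (x : X) (e : R) : continuous c -> 0 < e ->
  \forall x' \near x, forall y, `|c (x, y) - c (x', y)| <= e.
Proof.
move=> cc e0; have e2 : 0 < e / 2 by rewrite divr_gt0.
have := (compact_near_coveringP [set: X]).1 cptX X (nbhs x)
  (fun x' y => `|c (x, y) - c (x', y)| <= e) _.
move=> H; suff : \forall x' \near x, [set: X] `<=` (fun y => `|c (x, y) - c (x', y)| <= e).
  by apply: filterS => x' xx' y; exact: xx'.
apply: H => y _.
have /cvgrPdist_le/(_ _ e2) := cc (x, y).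
move=> [[A B] [/= nA nB] AB]; exists (B, A) => //= -[y' x'] [/= By' Ax'].
have := AB (x, y') (conj (nbhs_singleton nA) By'); have := AB (x', y') (conj Ax' By').
by rewrite /= !ler_norml => /andP[? ?] /andP[? ?]; apply/andP; split; lra.
Qed.

Lemma equicontinuous_right (c : X * X -> R) (y : X) (e : R) : continuous c -> 0 < e ->
  \forall y' \near y, forall x, `|c (x, y) - c (x, y')| <= e.
Proof.
move=> cc; apply: (@equicontinuous_left (fun z => c (z.2, z.1))) => z.
apply: (@continuous_comp _ _ _ (fun z : X * X => (z.2, z.1)) c); last exact: cc.
by apply: (@cvg_pair _ X X (nbhs z) (nbhs z.2) (nbhs z.1) _ _ _ snd fst);
  [exact: cvg_snd|exact: cvg_fst].
Qed.

(** With an intermediate point present, the two end points enter through different steps, the first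
    and the last. The rest [G x] of the cost is independent of them, so the costs form an
    equicontinuous family indexed by free sequences. *)
Lemma reduced_cost_continuous (c : X * X -> R) (f : X -> R) (n : nat) :
  (0 < n)%N -> continuous c -> continuous f -> continuous (reduced_cost c f n).
Proof.
case: n => // n _ cc cf.
pose G (x : nat -> X) : R := \sum_(1 <= i < n.+1) c (x i, x i.+1)
  - \sum_(1 <= i < n.+2) f (x i).
pose F (x : nat -> X) (z : X * X) : R := c (z.1, x 1%N) + c (x n.+1, z.2) + G x.
have chainE (x : nat -> X) : \sum_(0 <= i < n.+2) c (x i, x i.+1)
    - \sum_(1 <= i < n.+2) f (x i) = F x (x 0%N, x n.+2).
  rewrite big_nat_recl // big_nat_recr // /F /G /=.
  rewrite (big_add1 _ _ 0 n.+1); lra.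
have valuesE z : chain_cost_values c f n.+1 z = [set F x z | x in setT].
  apply/seteqP; split => [_ [x [/= x0 xn] <-]|_ [x _ <-]].
    by exists x => //; rewrite chainE x0 xn; case: (z).
  (* [F x z] reads [x] only at the indices from 1 to [n.+1], so overwriting both ends leaves it
     unchanged. *)
  exists (fun i => if i == 0%N then z.1 else if i == n.+2 then z.2 else x i).
    by split; rewrite /= ?eqxx.
  rewrite chainE /F /G /= eqxx eqSS ltn_eqF //; congr (_ + (_ - _)).
    apply: eq_big_nat => -[//|i] /andP[_ iN].
    by rewrite /= eqSS ltn_eqF 1?ltnW // eqSS ltn_eqF.
  apply: eq_big_nat => -[//|i] /andP[_ iN].
  by rewrite /= eqSS ltn_eqF.
rewrite (_ : reduced_cost c f n.+1 = (fun z => inf [set F x z | x in setT])); last first.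
  by apply/funext => z; rewrite /reduced_cost valuesE.
apply: continuous_inf.
- by exists (fun=> point).
- move=> z; have [_ lb] := @reduced_costP R X c f n.+1 z cptX cc cf.
  by rewrite -valuesE; exists (reduced_cost c f n.+1 z).
- move=> -[z1 z2] e e0; have e2 : 0 < e / 2 by rewrite divr_gt0.
  have H1 := equicontinuous_left z1 cc e2; have H2 := equicontinuous_right z2 cc e2.
  exists ([set x' | forall y, `|c (z1, y) - c (x', y)| <= e / 2],
          [set y' | forall x, `|c (x, z2) - c (x, y')| <= e / 2]) => //=.
  move=> [z1' z2'] [/= h1 h2] x; have := h1 (x 1%N); have := h2 (x n.+1).
  by rewrite /F /= !ler_norml => /andP[? ?] /andP[? ?]; apply/andP; split; lra.
Qed.

(** The usual c-transform of [- u]; the sign is chosen so that [u x] is the cost accumulated on the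
    way to [x]. *)
Definition c_transform (c : X * X -> R) (u : X -> R) (y : X) : R :=
  inf [set u x + c (x, y) | x in setT].

Lemma c_transformP (c : X * X -> R) (u : X -> R) (y : X) :
  continuous c -> continuous u ->
  (exists x, c_transform c u y = u x + c (x, y)) /\
  forall x, c_transform c u y <= u x + c (x, y).
Proof.
move=> cc cu; have XX : [set: X] !=set0 by exists point.
have cuc : continuous (fun x => u x + c (x, y)).
  apply: continuous_add => // x.
  apply: (@continuous_comp _ _ _ (fun x => (x, y)) c); last exact: cc.
  by apply: (@cvg_pair _ X X (nbhs x) (nbhs x) (nbhs y) _ _ _ id (cst y));
    [exact: cvg_id|exact: cvg_cst].
have [x _ xmin] := compact_EVT_min XX cptX (continuous_subspaceT cuc).
have lb : lbound [set u x + c (x, y) | x in setT] (u x + c (x, y)).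
  by move=> _ [t _ <-]; apply: xmin; exact: mem_set.
have le t : c_transform c u y <= u t + c (t, y).
  by apply: ge_inf; [exists (u x + c (x, y))|exists t].
split => //; exists x; apply/eqP; rewrite eq_le le.
by apply: lb_le_inf => //; exists (u x + c (x, y)), x.
Qed.

Lemma c_transform_continuous (c : X * X -> R) (u : X -> R) :
  continuous c -> continuous u -> continuous (c_transform c u).
Proof.
move=> cc cu; apply: (@continuous_inf X X (fun x y => u x + c (x, y))).
- by exists point.
- move=> y; exists (c_transform c u y) => _ [x _ <-].
  exact: (c_transformP y cc cu).2.
- move=> y e e0; have := equicontinuous_right y cc e0.
  by apply: filterS => y' h x; rewrite opprD addrACA subrr add0r.
Qed.

End infimum_continuity.

(** * Potentials and weak duality *)

Section kantorovich.
Context {R : realType} {X : pMetricType R}.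
Hypothesis cptX : compact [set: X].
Implicit Types (mu nu : probability (borel X) R) (b : X * X -> R).

Let cptXX : compact [set: X * X].
Proof. by rewrite -setXTT; exact: compact_setX. Qed.

Let chain_pair (z : X * X) : nat -> X := fun i => if i == 0%N then z.1 else z.2.

(* This is the duality for chains without intermediate points: for [n = 0] the
   third measure plays no role. *)
Lemma kantorovich_duality b mu nu : continuous b ->
  exists2 pi, coupling mu nu pi &
    forall e : R, 0 < e -> exists phi psi : X -> R, [/\ continuous phi, continuous psi,
      forall z, phi z.1 + psi z.2 <= b z &
      (\int[pi]_z b z <= \int[mu]_x phi x + \int[nu]_x psi x + e)%R].
Proof.
move=> cb.
have [rho [pi [rho0 rho1 _ pic dual]]] := chain_duality cptX mu nu mu 0 cb.
exists (pi 0%N); first by have := pic 0%N; rewrite rho0 rho1.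
move=> e e0; have [phi [psi [f [[cphi cpsi _] test le]]]] := dual e e0.
exists phi, psi; split => //.
  move=> z; have := test (chain_pair z).
  by rewrite /chain_test big_nat1 big_geq // addr0 /=; case: (z).
by move: le; rewrite big_nat1 /chain_dual_value mul0r addr0.
Qed.

Lemma coupling_fst mu nu pi (f : X -> R) : coupling mu nu pi -> continuous f ->
  (\int[pi]_z f z.1 = \int[mu]_x f x)%R.
Proof.
move=> pic cf.
have mfst : measurable_fun setT (fst : borel (X * X)%type -> borel X).
  apply: (@measurability _ _ _ (borel X) _ _ (@open X)) => //.
  move=> _ [U oU <-]; rewrite setTI; apply: sub_sigma_algebra.
  by apply: (open_comp _ oU) => z _; exact: cvg_fst.
have [Q [QE Qint]] := pushforward_probability pi mfst.
rewrite -Qint; last 2 first.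
- exact: continuous_borel_measurable.
- exact: continuous_bounded cptX _ cf.
congr fine; apply: eq_measure_integral => A mA _.
by transitivity (pi (fst @^-1` A)); [exact: QE|exact: (pic A mA).1].
Qed.

Lemma coupling_snd mu nu pi (f : X -> R) : coupling mu nu pi -> continuous f ->
  (\int[pi]_z f z.2 = \int[nu]_x f x)%R.
Proof.
move=> pic cf.
have msnd : measurable_fun setT (snd : borel (X * X)%type -> borel X).
  apply: (@measurability _ _ _ (borel X) _ _ (@open X)) => //.
  move=> _ [U oU <-]; rewrite setTI; apply: sub_sigma_algebra.
  by apply: (open_comp _ oU) => z _; exact: cvg_snd.
have [Q [QE Qint]] := pushforward_probability pi msnd.
rewrite -Qint; last 2 first.
- exact: continuous_borel_measurable.
- exact: continuous_bounded cptX _ cf.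
congr fine; apply: eq_measure_integral => A mA _.
by transitivity (pi (snd @^-1` A)); [exact: QE|exact: (pic A mA).2].
Qed.

Lemma transport_cost_ge b mu nu (phi psi : X -> R) :
  continuous b -> continuous phi -> continuous psi ->
  (forall z, phi z.1 + psi z.2 <= b z) ->
  (\int[mu]_x phi x + \int[nu]_x psi x)%R <= transport_cost b mu nu.
Proof.
(* The duality only supplies a coupling here: a lower bound passes to the infimum of a nonempty
   set. *)
move=> cb cphi cpsi le_b; have [pi0 pi0c _] := kantorovich_duality mu nu cb.
apply: lb_le_inf; first by exists (\int[pi0]_z b z)%R, pi0.
move=> _ [pi pic <-].
have cphi1 : continuous (fun z : X * X => phi z.1).
  by move=> z; apply: (@continuous_comp _ _ _ fst phi); [exact: cvg_fst|exact: cphi].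
have cpsi2 : continuous (fun z : X * X => psi z.2).
  by move=> z; apply: (@continuous_comp _ _ _ snd psi); [exact: cvg_snd|exact: cpsi].
rewrite -(coupling_fst pic cphi) -(coupling_snd pic cpsi).
rewrite -(Rintegral_continuousD cptXX) //.
by apply: le_Rintegral_continuous => //; exact: continuous_add.
Qed.

Lemma transport_cost_le b mu nu pi : continuous b -> coupling mu nu pi ->
  transport_cost b mu nu <= (\int[pi]_z b z)%R.
Proof.
move=> cb pic; apply: ge_inf; last by exists pi.
have [M bM] := continuous_bounded cptXX cb.
exists (- M) => _ [pi' _ <-]; rewrite -[leLHS](Rintegral_probability_cst pi').
apply: le_Rintegral_continuous => //; first exact: cst_continuous.
by move=> z; have := bM z; rewrite ler_norml => /andP[].
Qed.

End kantorovich.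

(** * Iterated c-transforms along a chain of measures *)

Section potentials.
Context {R : realType} {X : pMetricType R}.
Hypothesis cptX : compact [set: X].
Variables (c : X * X -> R) (phi f : X -> R).
Hypotheses (cc : continuous c) (cphi : continuous phi) (cf : continuous f).

(* The least value of [- phi x_0 + sum c - sum f] along the chains with [k]
   steps that end at [y]; the end point contributes [- f y] when [0 < k]. *)
Fixpoint potential (k : nat) : X -> R :=
  if k is k.+1 then fun y => c_transform c (potential k) y - f y
  else fun y => - phi y.

Lemma potential_continuous k : continuous (potential k).
Proof.
elim: k => [|k IH] /=; first by move=> x; apply: cvgN; exact: cphi.
by move=> y; apply: cvgB; [exact: c_transform_continuous|exact: cf].
Qed.

(** The minimizers of the successive transforms, read backwards from [y], form the chain. The last
    transform is taken before [f] is subtracted, so the end point [y] carries no weight and [k]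
    intermediate points remain. *)
Lemma potential_chain k y : exists2 x : nat -> X, x k.+1 = y &
  c_transform c (potential k) y = - phi (x 0%N)
    + \sum_(0 <= i < k.+1) c (x i, x i.+1) - \sum_(1 <= i < k.+1) f (x i).
Proof.
elim: k y => [|k IH] y.
  have [[a ->] _] := c_transformP cptX y cc (@potential_continuous 0).
  exists (fun i => if i == 0%N then a else y) => //.
  by rewrite big_nat1 big_geq //= subr0.
have [[a ->] _] := c_transformP cptX y cc (@potential_continuous k.+1).
have [x xk /= ->] := IH a.
pose x' i := if i == k.+2 then y else x i.
have x'E i : (i <= k.+1)%N -> x' i = x i by move=> ik; rewrite /x' ltn_eqF.
have x'y : x' k.+2 = y by rewrite /x' eqxx.
exists x' => //; rewrite [in RHS]big_nat_recr //.
rewrite [\sum_(1 <= i < k.+2) _ in RHS]big_nat_recr //= x'y !x'E // xk.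
have -> : \sum_(0 <= i < k.+1) c (x' i, x' i.+1) =
    \sum_(0 <= i < k.+1) c (x i, x i.+1).
  by apply: eq_big_nat => i /andP[_ ik]; rewrite !x'E // ltnW.
have -> : \sum_(1 <= i < k.+1) f (x' i) = \sum_(1 <= i < k.+1) f (x i).
  by apply: eq_big_nat => i /andP[_ ik]; rewrite x'E // ltnW.
lra.
Qed.

(** The negative of a potential and its c-transform are admissible potentials for [c], so
    [transport_cost_ge] bounds each step by a difference of integrals, and these differences
    telescope up to the integrals of [f]. *)
Lemma potential_transport_cost (rho : nat -> probability (borel X) R) k :
  (\int[rho k]_x potential k x + \sum_(1 <= i < k.+1) \int[rho i]_x f x
    + \int[rho 0%N]_x phi x)%R
  <= \sum_(0 <= i < k) transport_cost c (rho i) (rho i.+1).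
Proof.
elim: k => [|k IH].
  rewrite !big_geq //= addr0 -(Rintegral_continuousD cptX) //; last first.
    exact: (@potential_continuous 0).
  under eq_Rintegral do rewrite addNr.
  by rewrite Rintegral_probability_cst.
rewrite big_nat_recr //= [leRHS]big_nat_recr //=.
have cT := c_transform_continuous cptX cc (@potential_continuous k).
rewrite (Rintegral_continuousB cptX) //.
have cN : continuous (fun x => -1 * potential k x).
  by apply: continuous_scale; exact: potential_continuous.
have := transport_cost_ge cptX (rho k) (rho k.+1) cc cN cT.
rewrite (Rintegral_continuousZ cptX); last exact: potential_continuous.
move=> /(_ _)/(le_trans _) H.
have step : (\int[rho k.+1]_x c_transform c (potential k) x
    - \int[rho k]_x potential k x)%R <= transport_cost c (rho k) (rho k.+1).
  rewrite addrC -mulN1r; apply: H => //= z.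
  have := (c_transformP cptX z.2 cc (@potential_continuous k)).2 z.1.
  by case: (z) => z1 z2 /=; lra.
by move: step IH; lra.
Qed.

End potentials.

Lemma weak_duality (R : realType) (X : pMetricType R) (c : X * X -> R) (f : X -> R)
    (n : nat) (rho : nat -> probability (borel X) R) :
  compact [set: X] -> continuous c -> continuous f -> (0 < n)%N ->
  transport_cost (reduced_cost c f n) (rho 0%N) (rho n.+1)
    + \sum_(1 <= i < n.+1) (\int[rho i]_x f x)%R
  <= \sum_(0 <= i < n.+1) transport_cost c (rho i) (rho i.+1).
Proof.
move=> cptX cc cf n0; have cred := reduced_cost_continuous cptX n0 cc cf.
apply/ler_addgt0Pr => e e0.
have [pi pic dual] := kantorovich_duality cptX (rho 0%N) (rho n.+1) cred.
have [phi [psi [cphi cpsi test le]]] := dual e e0.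
(* The chain behind the transform at [y] competes in the reduced cost from [x 0%N] to [y], which in
   turn dominates [phi (x 0%N) + psi y]. *)
have psi_le y : psi y <= c_transform c (potential c phi f n) y.
  have [x xn ->] := potential_chain cptX cc cphi cf n y.
  have := test (x 0%N, x n.+1); rewrite xn /=.
  have [_ lb] := reduced_costP n (x 0%N, y) cptX cc cf.
  have := lb _ (ex_intro2 _ _ x (conj erefl xn) erefl); lra.
have cT := c_transform_continuous cptX cc (potential_continuous cptX cc cphi cf (k:=n)).
have psi_int := le_Rintegral_continuous cptX (rho n.+1) cpsi cT psi_le.
have := potential_transport_cost cptX cc cphi cf rho n.+1.
(* The [- f] in the last potential cancels the summand of index [n.+1], leaving the intermediate
   measures only. *)
rewrite [in leLHS]big_nat_recr //= (Rintegral_continuousB cptX) //.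
have := transport_cost_le cptX cred pic; lra.
Qed.

(** * Strong duality and the final identity *)

Lemma strong_duality (R : realType) (X : pMetricType R) (c : X * X -> R)
    (mu nu lambda : probability (borel X) R) (n : nat) :
  compact [set: X] -> continuous c -> (0 < n)%N ->
  exists2 v, constrained_cost_values c n lambda mu nu v &
    forall e : R, 0 < e -> exists2 f : X -> R, continuous f &
      v <= transport_cost (reduced_cost c f n) mu nu
           + n%:R * (\int[lambda]_x f x)%R + e.
Proof.
move=> cptX cc n0.
have [rho [pi [rho0 rhon rhos pic dual]]] := chain_duality cptX mu nu lambda n cc.
exists (\sum_(0 <= i < n.+1) transport_cost c (rho i) (rho i.+1)).
  by exists rho.
move=> e e0; have [phi [psi [f [[cphi cpsi cf] test le]]]] := dual e e0.
exists f => //; have cred := reduced_cost_continuous cptX n0 cc cf.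
(* The reduced cost is attained at some chain, and admissibility along that chain is the claim. *)
have pp z : phi z.1 + psi z.2 <= reduced_cost c f n z.
  have [[x [/= x0 xn] <-] _] := reduced_costP n z cptX cc cf.
  by have := test x; rewrite /chain_test x0 xn; lra.
have := transport_cost_ge cptX mu nu cred cphi cpsi pp.
have : \sum_(0 <= i < n.+1) transport_cost c (rho i) (rho i.+1)
    <= \sum_(0 <= i < n.+1) (\int[pi i]_z c z)%R.
  by apply: ler_sum => i _; exact: transport_cost_le.
by move: le; rewrite /chain_dual_value; lra.
Qed.

Theorem theorem6p4 (R : realType) (X : pMetricType R)
    (hX : compact [set: X])
    (c : X * X -> R) (hc : continuous c)
    (mu nu lambda : probability (borel X) R)
    (n : nat) (hn : (0 < n)%N) :
  is_min (constrained_cost_values c n lambda mu nu)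
         (constrained_cost c n lambda mu nu) /\
  (constrained_cost c n lambda mu nu)%:E =
    ereal_sup [set (transport_cost (reduced_cost c f n) mu nu
                    + n%:R * (\int[lambda]_x f x)%R)%:E
              | f in [set f : X -> R | continuous f]].
Proof.
have [v vP near_v] := strong_duality mu nu lambda hX hc hn.
have weak w f : constrained_cost_values c n lambda mu nu w -> continuous f ->
    transport_cost (reduced_cost c f n) mu nu + n%:R * (\int[lambda]_x f x)%R <= w.
  move=> [rho [rho0 rhon rhos] <-] cf; rewrite -rho0 -rhon.
  by rewrite -((sum_measureP hX rho lambda n).1 rhos f cf); exact: weak_duality.
(* Up to [e], [v] is below the dual value of a single [f], which weak duality places below every
   feasible value. *)
have vL : lbound (constrained_cost_values c n lambda mu nu) v.
  move=> w wP; apply/ler_addgt0Pr => e e0; have [f cf /le_trans] := near_v e e0.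
  by apply; rewrite lerD2r; exact: weak.
have -> : constrained_cost c n lambda mu nu = v.
  apply/eqP; rewrite eq_le; apply/andP; split.
    by apply: ge_inf => //; exists v.
  by apply: lb_le_inf => //; exists v.
split=> //; apply/eqP; rewrite eq_le; apply/andP; split.
  apply/lee_addgt0Pr => e e0; have [f cf vf] := near_v e e0.
  apply: (@le_trans _ _ ((transport_cost (reduced_cost c f n) mu nu
    + n%:R * (\int[lambda]_x f x)%R)%:E + e%:E)%E); first by rewrite -EFinD lee_fin.
  by apply: leeD2r; apply: ereal_sup_ubound; exists f.
by apply: ge_ereal_sup => _ [f cf <-]; rewrite lee_fin; exact: weak.
Qed.
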